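(* Let $n\geqslant1$, let $M\in\{\mathrm{IEnd}(S_n),\mathrm{PEnd}(S_n),\mathrm{PwEnd}(S_n)\}$ and let $\alpha,\beta\in M$. Then $\alpha\,\mathscr{L}\,\beta$ in $M$ if and only if one of the following properties is satisfied: (1) $\mathrm{Im}(\alpha)=\mathrm{Im}(\beta)$ and $|\mathrm{Im}(\alpha)|\leqslant1$; (2) $\mathrm{Im}(\alpha)=\mathrm{Im}(\beta)$, $|\mathrm{Im}(\alpha)|\geqslant2$, and [$0\in\mathrm{Dom}(\alpha)$ if and only if $0\in\mathrm{Dom}(\beta)$].
   Context: For $n\geqslant1$, the star graph $S_n$ is the simple graph with vertex set $V=\{0,1,\ldots,n-1\}$ and edge set $E=\{\{0,i\}\mid 1\leqslant i\leqslant n-1\}$. $\mathcal{PT}(V)$ is the monoid of all partial transformations of $V$ (including the empty one) under composition; maps are written on the right and composed left to right. For a graph $G=(V,E)$, $\mathrm{PEnd}(G)$ is the monoid of partial endomorphisms: those $\alpha\in\mathcal{PT}(V)$ with $\{u,v\}\in E\Rightarrow\{u\alpha,v\alpha\}\in E$ for all $u,v\in\mathrm{Dom}(\alpha)$. $\mathrm{PwEnd}(G)$ is the monoid of partial weak endomorphisms: those $\alpha\in\mathcal{PT}(V)$ such that $\{u,v\}\in E$ and $u\alpha\neq v\alpha$ imply $\{u\alpha,v\alpha\}\in E$ for all $u,v\in\mathrm{Dom}(\alpha)$. $\mathrm{IEnd}(G)$ is the monoid of injective elements of $\mathrm{PEnd}(G)$. Green's relation $\mathscr{L}$ on a monoid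 $M$: $\alpha\,\mathscr{L}\,\beta$ iff $M\alpha=M\beta$. *)

(* Defs.v *)
(* MathComp *)
From HB Require Import structures.
From mathcomp Require Import all_boot.

Set Implicit Arguments.
Unset Strict Implicit.
Unset Printing Implicit Defensive.

Local Open Scope group_scope.

Record sgraph (T : finType) := SGraph {
  edges : {set {set T}};
  edges_card2 : {in edges, forall e : {set T}, #|e| = 2}
}.

Section Star.
Variables (n : nat) (n_ge1 : 1 <= n).

Definition star_center : 'I_n := Ordinal n_ge1.

Definition star_edges : {set {set 'I_n}} :=
  [set [set star_center; i] | i in [set i : 'I_n | 1 <= i]].

Fact star_edges_card2 : {in star_edges, forall e : {set 'I_n}, #|e| = 2}.
Proof.
move=> e /imsetP[i]; rewrite inE => i_gt0 ->.
by rewrite cards2 -val_eqE /= eq_sym -lt0n i_gt0.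
Qed.

Definition star : sgraph 'I_n := SGraph star_edges_card2.

End Star.

(* A partial transformation sends v to None when it is undefined at v. *)
Definition ptrans (T : finType) := {ffun T -> option T}.

HB.instance Definition _ (T : finType) := Finite.on (ptrans T).

Section PartialTransformations.
Variable T : finType.
Implicit Types (a b c : ptrans T) (G : sgraph T).

Definition pdom a : {set T} := [set u | a u != None].
Definition pim a : {set T} := [set v | [exists u, a u == Some v]].

(* Maps act on the right: a * b applies a first, then b. *)
Definition pcomp a b : ptrans T := [ffun u => obind b (a u)].
Definition pid : ptrans T := [ffun u => Some u].

Fact pcompA : associative pcomp.
Proof. by move=> a b c; apply/ffunP=> u; rewrite !ffunE; case: (a u) => //= v; rewrite ffunE. Qed.

Fact pcomp1l : left_id pid pcomp.
Proof. by move=> a; apply/ffunP=> u; rewrite !ffunE. Qed.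

Fact pcomp1r : right_id pid pcomp.
Proof. by move=> a; apply/ffunP=> u; rewrite !ffunE; case: (a u) => //= v; rewrite ffunE. Qed.

HB.instance Definition _ := isMonoid.Build (ptrans T) pcompA pcomp1l pcomp1r.

Definition PEnd G : {set ptrans T} :=
  [set a : ptrans T | [forall u, forall v,
    if (a u, a v) is (Some u', Some v')
    then ([set u; v] \in edges G) ==> ([set u'; v'] \in edges G)
    else true]].

Definition PwEnd G : {set ptrans T} :=
  [set a : ptrans T | [forall u, forall v,
    if (a u, a v) is (Some u', Some v')
    then ([set u; v] \in edges G) && (u' != v') ==>
         ([set u'; v'] \in edges G)
    else true]].

Definition IEnd G : {set ptrans T} :=
  [set a in PEnd G | dinjectiveb a (pdom a)].

Fact PEnd_monoid G : monoid_closed (PEnd G).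
Proof.
split=> [|a b]; rewrite !inE.
  by apply/forallP=> u; apply/forallP=> v; rewrite !ffunE; apply/implyP.
move=> /forallP Ha /forallP Hb; apply/forallP=> u; apply/forallP=> v.
rewrite !ffunE; move/forallP: (Ha u) => /(_ v).
case: (a u) => // u'; case: (a v) => [v'|] /=; last by case: (b u').
move/forallP: (Hb u') => /(_ v').
by case: (b u') => // u''; case: (b v') => // v'' /implyP H /implyP K;
  apply/implyP=> /K.
Qed.

Fact PwEnd_monoid G : monoid_closed (PwEnd G).
Proof.
split=> [|a b]; rewrite !inE.
  by apply/forallP=> u; apply/forallP=> v; rewrite !ffunE;
    apply/implyP=> /andP[].
move=> /forallP Ha /forallP Hb; apply/forallP=> u; apply/forallP=> v.
rewrite !ffunE; move/forallP: (Ha u) => /(_ v).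
case: (a u) => // u'; case: (a v) => [v'|] /=; last by case: (b u').
move/forallP: (Hb u') => /(_ v').
case eu: (b u') => [u''|] //; case ev: (b v') => [v''|] // /implyP H /implyP K.
apply/implyP=> /andP[uvE neq]; apply: H; rewrite neq andbT; apply: K.
rewrite uvE; apply: contraNneq neq => eq_uv.
by move: eu; rewrite eq_uv ev => -[->].
Qed.

Fact IEnd_monoid G : monoid_closed (IEnd G).
Proof.
have [P1 PM] := PEnd_monoid G; split=> [|a b].
  by rewrite inE P1; apply/dinjectiveP=> u v _ _; rewrite !ffunE => -[].
rewrite !(inE, in_setI) => /andP[Pa /dinjectiveP Ia] /andP[Pb /dinjectiveP Ib].
move: (PM a b); rewrite !inE => -> //=.
apply/dinjectiveP=> u v; rewrite !inE !ffunE.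
case eu: (a u) => [u'|] //=; case ev: (a v) => [v'|] //= Du Dv eq_uv.
apply: Ia; rewrite ?inE ?eu ?ev //; congr Some.
by apply: Ib; rewrite ?inE.
Qed.

Definition left_ideal (M : {set ptrans T}) a : {set ptrans T} :=
  [set g * a | g : ptrans T in M].

(* Green's relation L of the submonoid M; it is meaningful only for a and b
   in M. *)
Definition greenL (M : {set ptrans T}) a b : Prop :=
  left_ideal M a = left_ideal M b.

End PartialTransformations.

(* Main.v *)
(** The preorder underlying L has a one-sided description: a lies in M b iff
    Im a is contained in Im b and, when |Im a| >= 2, the centre 0 lies in Dom b
    as soon as it lies in Dom a.  If a = g b and 0, v in Dom a have different
    images, then {0g, vg} is an edge contained in Dom b, and every edge contains
    0.  Conversely, take g = a s, where s is a section of b over Im b that sends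
    0b to 0: this g has the same domain and kernel as a, so only weak
    edge-preservation must be checked, and it holds because whenever 0a <> va
    one of 0a and va equals 0b.  The same g works for the three monoids. *)
Require Import Defs.
From mathcomp Require Import all_boot.

Set Implicit Arguments.
Unset Strict Implicit.
Unset Printing Implicit Defensive.

Local Open Scope group_scope.

(** * Principal left ideals, and endomorphisms of an arbitrary graph *)

Section PartialTransformations.
Variable T : finType.
Implicit Types (a b g : ptrans T) (G : sgraph T) (M : {set ptrans T}).

Lemma ptransM a b u : (a * b) u = obind b (a u).
Proof. exact: ffunE. Qed.

Lemma pimP a w : reflect (exists u, a u = Some w) (w \in pim a).
Proof.
by rewrite inE; apply: (iffP existsP) => -[u /eqP au]; exists u => //; apply/eqP.
Qed.

Lemma mem_pim a u w : a u = Some w -> w \in pim a.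
Proof. by move=> au; apply/pimP; exists u. Qed.

Lemma pdomP a u : reflect (exists w, a u = Some w) (u \in pdom a).
Proof.
rewrite inE; case: (a u) => [w|]; constructor; first by exists w.
by case.
Qed.

Lemma pim_mulr g b : pim (g * b) \subset pim b.
Proof.
apply/subsetP=> w /pimP[u]; rewrite ptransM.
by case: (g u) => //= v /mem_pim.
Qed.

(** Since [M] contains 1, [a] lies in its own left ideal; conversely [h * (g * b) = (h * g) * b].
    Through this, Green's relation splits into two memberships that can be treated separately. *)
Lemma left_ideal_sub M a b : monoid_closed M -> a \in M ->
  (left_ideal M a \subset left_ideal M b) = (a \in left_ideal M b).
Proof.
move=> [M1 MM] aM; apply/subsetP/imsetP => [sub|[g gM ->] _ /imsetP[h hM ->]].
  by apply/imsetP/sub/imsetP; exists 1; rewrite ?mul1g.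
by apply/imsetP; exists (h * g); rewrite ?MM ?mulgA.
Qed.

Lemma greenLE M a b : monoid_closed M -> a \in M -> b \in M ->
  greenL M a b <-> a \in left_ideal M b /\ b \in left_ideal M a.
Proof.
move=> Mm aM bM; rewrite -!left_ideal_sub //; split=> [->|[sab sba]] //.
by apply/eqP; rewrite eqEsubset sab sba.
Qed.

Lemma PwEndP G a :
  reflect (forall u v u' v', a u = Some u' -> a v = Some v' ->
             [set u; v] \in edges G -> u' != v' -> [set u'; v'] \in edges G)
          (a \in PwEnd G).
Proof.
rewrite inE; apply: (iffP forallP) => [aG u v u' v' au av uvE neq|aG u].
  have /forallP/(_ v) := aG u.
  by rewrite au av uvE neq.
apply/forallP=> v; case au: (a u) => [u'|] //; case av: (a v) => [v'|] //.
by apply/implyP=> /andP[]; apply: aG.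
Qed.

Lemma PEndP G a :
  reflect (forall u v u' v', a u = Some u' -> a v = Some v' ->
             [set u; v] \in edges G -> [set u'; v'] \in edges G)
          (a \in PEnd G).
Proof.
rewrite inE; apply: (iffP forallP) => [aG u v u' v' au av uvE|aG u].
  have /forallP/(_ v) := aG u.
  by rewrite au av uvE.
apply/forallP=> v; case au: (a u) => [u'|] //; case av: (a v) => [v'|] //.
by apply/implyP; apply: aG.
Qed.

Lemma edge_neq G u v : [set u; v] \in edges G -> u != v.
Proof. by move/edges_card2; rewrite cards2; case: (u != v). Qed.

Lemma PEnd_sub_PwEnd G : PEnd G \subset PwEnd G.
Proof.
apply/subsetP=> a /PEndP aG; apply/PwEndP=> u v u' v' au av uvE _.
exact: aG au av uvE.
Qed.

Lemma IEnd_sub_PEnd G : IEnd G \subset PEnd G.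
Proof. by apply/subsetP=> a /setIdP[]. Qed.

Section KernelTransfer.
Variables (G : sgraph T) (a g : ptrans T).
Hypotheses (dom_ga : pdom g \subset pdom a)
           (ker_ga : forall u v, g u = g v -> a u = a v)
           (gW : g \in PwEnd G).

(** A weak endomorphism can break an edge only by collapsing it. If [g] collapsed an edge, so would
    [a], whereas [a] sends it to an edge, which has two distinct ends. *)
Lemma PEnd_transfer : a \in PEnd G -> g \in PEnd G.
Proof.
move=> /PEndP aG; apply/PEndP=> u v u' v' gu gv uvE.
apply: (PwEndP _ _ gW _ _ _ _ gu gv uvE); apply/eqP=> equv.
have /pdomP[u1 au] : u \in pdom a by apply: (subsetP dom_ga); apply/pdomP; exists u'.
have av : a v = Some u1 by rewrite -au; apply: ker_ga; rewrite gu gv equv.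
by have /edge_neq := aG _ _ _ _ au av uvE; rewrite eqxx.
Qed.

Lemma IEnd_transfer : a \in IEnd G -> g \in IEnd G.
Proof.
case/setIdP=> aP /dinjectiveP inj_a; apply/setIdP; split; first exact: PEnd_transfer.
by apply/dinjectiveP=> u v gu gv /ker_ga; apply: inj_a; apply: (subsetP dom_ga).
Qed.

End KernelTransfer.

End PartialTransformations.

(** * Weak endomorphisms of the star and sections that favour the centre *)

Section Star.
Variables (n : nat) (n_ge1 : 1 <= n).
Let c := star_center n_ge1.
Let G := star n_ge1.
Implicit Types (a b g : ptrans 'I_n) (M : {set ptrans 'I_n}).

Lemma star_edgeE u v :
  ([set u; v] \in edges G) = (u != v) && ((u == c) || (v == c)).
Proof.
have posE (i : 'I_n) : (0 < i) = (i != c) by rewrite lt0n.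
apply/idP/idP=> [uvE|/andP[neq /orP[]/eqP eqc]].
- rewrite (edge_neq uvE) /=; case/imsetP: uvE => i _ /setP/(_ c).
  by rewrite !inE eqxx /= ![c == _]eq_sym.
- by rewrite eqc; apply/imsetP; exists v => //; rewrite inE posE eq_sym -eqc.
- by rewrite eqc setUC; apply/imsetP; exists u => //; rewrite inE posE -eqc.
Qed.

(** Every edge contains the centre, so by symmetry only pairs formed by [c] and a vertex [v] need
    testing. The case [v = c] is harmless, since it forces [c' = v']. *)
Lemma star_PwEndP a :
  reflect (forall v c' v', a c = Some c' -> a v = Some v' ->
             c' != v' -> (c' == c) || (v' == c))
          (a \in PwEnd G).
Proof.
apply: (iffP (PwEndP _ _)) => [aG v c' v' ac av neq|aG u v u' v' au av].
  have cv : c != v by apply: contraNneq neq => eqv; move: av; rewrite -eqv ac => -[->].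
  have := aG _ _ _ _ ac av; rewrite !star_edgeE cv eqxx neq /=; exact.
rewrite !star_edgeE => /andP[_ /orP[]/eqP eqc] neq; rewrite neq /=; subst.
  exact: aG au av neq.
by rewrite orbC; apply: aG av au _; rewrite eq_sym.
Qed.

(** Outside [pim b] the [pick] returns [None], so the domain is exactly [pim b]. The centre takes
    precedence over every other preimage. *)
Definition csection b : ptrans 'I_n :=
  [ffun w => if b c == Some w then Some c else [pick x | b x == Some w]].

Lemma csectionK b w x : csection b w = Some x -> b x = Some w.
Proof.
rewrite ffunE; case: eqP => [bc [<-] //|_].
by case: pickP => // y /eqP by_ [<-].
Qed.

Lemma csection_def b w : w \in pim b -> exists x, csection b w = Some x.
Proof.
case/pimP=> x bx; rewrite ffunE; case: eqP => _; first by exists c.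
by case: pickP => [y _|/(_ x)]; [exists y | rewrite bx eqxx].
Qed.

Lemma csection_center b w : b c = Some w -> csection b w = Some c.
Proof. by move=> bc; rewrite ffunE bc eqxx. Qed.

Lemma mul_csection a b : pim a \subset pim b -> a * csection b * b = a.
Proof.
move=> sab; apply/ffunP=> u; rewrite !ptransM.
case au: (a u) => [w|] //=.
have [x sx] := csection_def (subsetP sab _ (mem_pim au)).
by rewrite sx /= (csectionK sx).
Qed.

Lemma csection_PwEnd a b : a \in PwEnd G -> b \in PwEnd G ->
  pim a \subset pim b -> (1 < #|pim a| -> c \in pdom a -> c \in pdom b) ->
  a * csection b \in PwEnd G.
Proof.
move=> /star_PwEndP aG /star_PwEndP bG sab dom_ab.
apply/star_PwEndP=> v c' v'; rewrite !ptransM.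
case ac: (a c) => [x|] //=; case av: (a v) => [y|] //= sx sy neq.
have xy : x != y by apply: contraNneq neq => eqxy; move: sx; rewrite eqxy sy => -[->].
have xI := mem_pim ac; have yI := mem_pim av.
have card_a : 1 < #|pim a| by apply/card_gt1P; exists x, y.
have /pdomP[z bc] : c \in pdom b by apply: dom_ab => //; apply/pdomP; exists x.
(* The section sends [z], the image of the centre under [b], back to the centre. *)
suff /orP[/eqP xz|/eqP yz] : (x == z) || (y == z).
- by move: sx; rewrite xz (csection_center bc) => -[<-]; rewrite eqxx.
- by move: sy; rewrite yz (csection_center bc) => -[<-]; rewrite eqxx orbT.
(* Suppose that [z] differs from both [x] and [y]. As [b] is weak, either [z = c], and then neither
   [x] nor [y] is [c], contrary to [axy]; or [x = y = c], contrary to [xy]. *)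
apply: contraT; rewrite negb_or ![_ == z]eq_sym => /andP[zx zy].
have bx := bG _ _ _ bc (csectionK sx) zx.
have b_y := bG _ _ _ bc (csectionK sy) zy.
have axy := aG _ _ _ ac av xy.
case: (eqVneq z c) zx zy bx b_y => [-> | _ _ _ /eqP xc /eqP yc] /=.
  by rewrite ![c == _]eq_sym => /negPf xc /negPf yc; rewrite xc yc in axy.
by rewrite xc yc eqxx in xy.
Qed.

Lemma PwEnd_mul_center g b : g \in PwEnd G ->
  1 < #|pim (g * b)| -> c \in pdom (g * b) -> c \in pdom b.
Proof.
move=> /star_PwEndP gG card_gb /pdomP[w]; rewrite ptransM.
case gc: (g c) => [x|] //= bx.
(* A second image point yields a vertex [v] that [g * b], hence [g], separates from the centre. *)
have [w' /pimP[v]] : exists2 w', w' \in pim (g * b) & w' != w.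
  have /card_gt1P[w1 [w2 [w1I w2I neq]]] := card_gb.
  by case: (eqVneq w1 w) neq => [-> | w1w _]; [exists w2; rewrite // eq_sym | exists w1].
rewrite ptransM; case gv: (g v) => [y|] //= b_y neq.
have xy : x != y by apply: contraNneq neq => eqxy; move: bx; rewrite eqxy b_y => -[->].
by apply/pdomP; case/orP: (gG _ _ _ gc gv xy) => /eqP <-; [exists w | exists w'].
Qed.

(** * Membership in a left ideal, uniformly in the three monoids *)

Section StarMonoid.
Variable M : {set ptrans 'I_n}.
Hypothesis HM : [\/ M = IEnd G, M = PEnd G | M = PwEnd G].

Lemma star_monoid_closed : monoid_closed M.
Proof.
by case: HM => ->; [apply: IEnd_monoid | apply: PEnd_monoid | apply: PwEnd_monoid].
Qed.

Lemma star_monoid_sub_PwEnd : M \subset PwEnd G.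
Proof.
case: HM => -> //; last exact: PEnd_sub_PwEnd.
exact: subset_trans (IEnd_sub_PEnd _) (PEnd_sub_PwEnd _).
Qed.

Lemma mem_left_ideal_star a b : a \in M -> b \in M ->
  a \in left_ideal M b <->
  pim a \subset pim b /\ (1 < #|pim a| -> c \in pdom a -> c \in pdom b).
Proof.
move=> aM bM; have MW := subsetP star_monoid_sub_PwEnd; split.
  case/imsetP=> g gM ->; split; first exact: pim_mulr.
  exact/PwEnd_mul_center/MW.
case=> sab dom_ab; apply/imsetP; exists (a * csection b); last by rewrite mul_csection.
have gW := csection_PwEnd (MW _ aM) (MW _ bM) sab dom_ab.
have dom_ga : pdom (a * csection b) \subset pdom a.
  by apply/subsetP=> u; rewrite !inE ptransM; case: (a u).
(* Multiplying by [b] on the right recovers [a], so the product identifies no more points than [a]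
   does. *)
have ker_ga u v : (a * csection b) u = (a * csection b) v -> a u = a v.
  by move=> eq_g; rewrite -(mul_csection sab) !(ptransM _ b) eq_g.
case: HM aM => eM; rewrite eM in gW *.
- exact: IEnd_transfer.
- exact: PEnd_transfer.
- by [].
Qed.

End StarMonoid.

End Star.

Theorem proposition2p7 (n : nat) (n_ge1 : 1 <= n) (M : {set ptrans 'I_n})
  (HM : [\/ M = IEnd (star n_ge1), M = PEnd (star n_ge1)
          | M = PwEnd (star n_ge1)])
  (a b : ptrans 'I_n) (aM : a \in M) (bM : b \in M) :
  greenL M a b <->
  (pim a = pim b /\ #|pim a| <= 1) \/
  [/\ pim a = pim b, 2 <= #|pim a|
    & star_center n_ge1 \in pdom a <-> star_center n_ge1 \in pdom b].
Proof.
have mem_ab := mem_left_ideal_star HM aM bM.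
have mem_ba := mem_left_ideal_star HM bM aM.
apply: (iff_trans (greenLE (star_monoid_closed HM) aM bM)).
split=> [[/mem_ab[sab dab] /mem_ba[sba dba]]|].
  have eqI : pim a = pim b by apply/eqP; rewrite eqEsubset sab sba.
  case: (leqP #|pim a| 1) => card_a; [by left | right; split=> //].
  by split; [apply: dab | apply: dba; rewrite -eqI].
case=> [[eqI card_a]|[eqI _ [dab dba]]]; split; [apply/mem_ab | apply/mem_ba
  | apply/mem_ab | apply/mem_ba]; rewrite -eqI; split=> //.
(* With at most one image point, the condition on the centre is vacuous. *)
- by rewrite ltnNge card_a.
- by rewrite ltnNge card_a.
Qed.
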